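(* Let $G=\{g_1=1,g_2,\ldots,g_{4t}\}$ be a finite multiplicative group of order $4t$ (not necessarily abelian). Let $\mathbb{Q}[X_G]$ be the polynomial ring over $\mathbb{Q}$ in the $16t^2$ variables $x_{i,j}$, $g_i,g_j\in G$, and for $g_i,g_j,g_k\in G$ put $$p_{i,j,k}:=x_{i,j}-x_{ij,k}\,x_{j,k}\,x_{i,jk},$$ where $ij$ (resp. $jk$) denotes the index of the group element $g_ig_j$ (resp. $g_jg_k$). Let $$I_G:=\langle x_{i,j}^2-1,\ x_{1,j}-1,\ x_{i,1}-1 : g_i,g_j\in G\setminus\{1\}\rangle+\langle p_{i,j,k}: g_i,g_j,g_k\in G\rangle+\Big\langle \sum_{g_j\in G}x_{i,j} : g_i\in G\setminus\{1\}\Big\rangle\subset\mathbb{Q}[X_G].$$ Then $I_G$ is zero-dimensional, and the map sending a point $(p_{i,j})$ of the affine variety $V(I_G)$ to the $4t\times 4t$ matrix $(p_{i,j})$ is a bijection from $V(I_G)$ onto the set $\mathcal{H}_G$ of normalized cocyclic Hadamard matrices over $G$. Moreover $|\mathcal{H}_G|=\dim_{\mathbb{Q}}(\mathbb{Q}[X_G]/I_G)$.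
   Context: A (binary) cocycle over $G$ is a map $\psi:G\times G\to\{\pm1\}$ with $\psi(g_i,g_j)\psi(g_ig_j,g_k)=\psi(g_j,g_k)\psi(g_i,g_jg_k)$ for all $g_i,g_j,g_k\in G$; its cocyclic matrix is $M_\psi=(\psi(g_i,g_j))_{i,j}$. The cocycle (and its matrix) is normalized if $\psi(1,g)=\psi(g,1)=1$ for all $g\in G$; the paper works throughout with normalized cocycles. A Hadamard matrix of order $n$ is an $n\times n$ matrix with entries $\pm1$ satisfying $HH^T=nI$. A cocyclic Hadamard matrix over $G$ is a cocyclic matrix over $G$ that is Hadamard. $V(I)$ denotes the set of common zeros of the polynomials in $I$; $I$ is zero-dimensional if $V(I)$ is finite. *)

(* Defs.v *)
From HB Require Import structures.
From mathcomp Require Import all_boot all_order all_algebra all_fingroup.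
From mathcomp Require Import classical_sets functions cardinality.
From mathcomp Require Import mpoly.

Set Implicit Arguments.
Unset Strict Implicit.
Unset Printing Implicit Defensive.

Import GRing.Theory.

Local Open Scope classical_set_scope.
Local Open Scope ring_scope.

Definition ideal_gen (R : comNzRingType) (S : set R) : set R :=
  [set p | exists s : seq (R * R),
     (forall q, q \in s -> S q.2) /\ p = \sum_(q <- s) q.1 * q.2].

Definition ideal_add (R : comNzRingType) (I J : set R) : set R :=
  [set p | exists a b, [/\ I a, J b & p = a + b]].

(* Points are taken in an arbitrary extension field K of the rationals, given
   by iota; K may be the rationals themselves or an algebraic closure. *)
Definition zero_locus (K : fieldType) (iota : {rmorphism rat -> K}) (m : nat)
    (I : set {mpoly rat[m]}) : set 'rV[K]_m :=
  [set v | forall p, I p -> (map_mpoly iota p).@[v 0] = 0].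

(* The classes of b_0, ..., b_(d-1) modulo I form a basis of the rational
   vector space Q[X] / I. *)
Definition quotient_basis (m : nat) (I : set {mpoly rat[m]}) (d : nat)
    (b : 'I_d -> {mpoly rat[m]}) : Prop :=
  (forall c : 'I_d -> rat, I (\sum_i c i *: b i) -> forall i, c i = 0) /\
  (forall p, exists c : 'I_d -> rat, I (p - \sum_i c i *: b i)).

Definition quotient_dim (m : nat) (I : set {mpoly rat[m]}) (d : nat) : Prop :=
  exists b : 'I_d -> {mpoly rat[m]}, quotient_basis I b.

Section Cocycles.

Variables (gT : finGroupType) (R : comNzRingType).

Definition cocycle (psi : gT -> gT -> R) : Prop :=
  (forall a b, psi a b = 1 \/ psi a b = -1) /\
  (forall a b c,
     psi a b * psi (a * b)%g c = psi b c * psi a (b * c)%g).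

Definition normalized (psi : gT -> gT -> R) : Prop :=
  forall a, psi 1%g a = 1 /\ psi a 1%g = 1.

Definition hadamard (n : nat) (H : 'M[R]_n) : Prop :=
  (forall i j, H i j = 1 \/ H i j = -1) /\ H *m H^T = n%:R%:M.

Definition cocyclic_mx (n : nat) (g : 'I_n -> gT) (psi : gT -> gT -> R)
  : 'M[R]_n := \matrix_(i, j) psi (g i) (g j).

Definition cocyclic_hadamard (n : nat) (g : 'I_n -> gT) : set 'M[R]_n :=
  [set M | hadamard M /\
     exists psi, [/\ cocycle psi, normalized psi & M = cocyclic_mx g psi]].

End Cocycles.

Arguments cocyclic_hadamard {gT} R {n} g.

(* g lists the elements of the group and idx gives the index of an element. *)
Section CocyclicIdeal.

Variables (gT : finGroupType) (n : nat) (g : 'I_n -> gT) (idx : gT -> 'I_n).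

(* The pair (i, j) is numbered by mxvec_index, so that vec_mx turns a point
   of affine space into the matrix of its coordinates. *)
Definition xvar (i j : 'I_n) : {mpoly rat[n * n]} := 'X_(mxvec_index i j).

Definition pcoc (i j k : 'I_n) : {mpoly rat[n * n]} :=
  xvar i j - xvar (idx (g i * g j)%g) k * xvar j k * xvar i (idx (g j * g k)%g).

Definition norm_gens : set {mpoly rat[n * n]} :=
  [set p | exists i j, [/\ g i != 1%g, g j != 1%g &
     [\/ p = xvar i j ^+ 2 - 1,
         p = xvar (idx 1%g) j - 1 |
         p = xvar i (idx 1%g) - 1]]].

Definition coc_gens : set {mpoly rat[n * n]} :=
  [set p | exists i j k, p = pcoc i j k].

Definition row_sum_gens : set {mpoly rat[n * n]} :=
  [set p | exists i, g i != 1%g /\ p = \sum_j xvar i j].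

Definition cocyclic_ideal : set {mpoly rat[n * n]} :=
  ideal_add (ideal_add (ideal_gen norm_gens) (ideal_gen coc_gens))
            (ideal_gen row_sum_gens).

End CocyclicIdeal.

(* Main.v *)
Require Import Defs.
From HB Require Import structures.
From mathcomp Require Import all_boot all_order all_algebra all_fingroup.
From mathcomp Require Import boolp classical_sets functions cardinality.
From mathcomp Require Import mpoly ring.

Set Implicit Arguments.
Unset Strict Implicit.
Unset Printing Implicit Defensive.

Import GRing.Theory.

Local Open Scope classical_set_scope.
Local Open Scope card_scope.
Local Open Scope ring_scope.

(* Modulo the relations x_k^2 = 1 the indicator polynomials of the vertices of
   the cube {1, -1}^m decompose 1, and every p acts on the indicator of a vertex
   as the scalar p(vertex).  Hence for an ideal I containing all x_k^2 - 1 the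
   zeros of I are vertices, the same ones over every extension of Q, and their
   indicators form a basis of Q[X] / I.  The cocyclic ideal contains all
   x_{i,j}^2 - 1, and its zeros are the normalized cocyclic matrices with zero
   noninitial row sums, which are exactly the Hadamard ones. *)

(** * Ideals of a commutative ring, their generation and sums *)

Section Ideals.
Variable R : comNzRingType.
Implicit Types (I J L S : set R) (p q : R).

Definition is_ideal I :=
  [/\ I 0, forall p q, I p -> I q -> I (p + q) & forall a p, I p -> I (a * p)].

Lemma is_ideal_sum I (T : finType) (P : pred T) (F : T -> R) :
  is_ideal I -> (forall i, P i -> I (F i)) -> I (\sum_(i | P i) F i).
Proof. by case=> I0 ID _ IF; apply: big_ind. Qed.

Lemma is_idealB I p q : is_ideal I -> I p -> I q -> I (p - q).
Proof. by case=> _ ID IM Ip Iq; rewrite -mulN1r; apply/ID/IM. Qed.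

Lemma ideal_gen_is_ideal S : is_ideal (ideal_gen S).
Proof.
split=> [|p q [s [sS ->]] [r [rS ->]]|a p [s [sS ->]]].
- by exists [::]; rewrite big_nil.
- exists (s ++ r); rewrite big_cat; split=> // x.
  by rewrite mem_cat => /orP[/sS|/rS].
- exists [seq (a * x.1, x.2) | x <- s]; split=> [x /mapP[y /sS Sy ->]//|].
  by rewrite big_map mulr_sumr; apply: eq_bigr => x _; rewrite mulrA.
Qed.

Lemma ideal_add_is_ideal I J :
  is_ideal I -> is_ideal J -> is_ideal (ideal_add I J).
Proof.
move=> [I0 ID IM] [J0 JD JM].
split=> [|p q [a [b [Ia Jb ->]]] [c [d [Ic Jd ->]]]|c p [a [b [Ia Jb ->]]]].
- by exists 0, 0; rewrite addr0.
- by exists (a + c), (b + d); split; [exact: ID|exact: JD|exact: addrACA].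
- by exists (c * a), (c * b); split; [exact: IM|exact: JM|exact: mulrDr].
Qed.

Lemma sub_ideal_gen S : S `<=` ideal_gen S.
Proof.
move=> p Sp; exists [:: (1, p)]; rewrite big_seq1 mul1r; split=> // q.
by rewrite inE => /eqP->.
Qed.

Lemma sub_ideal_addl I J : is_ideal J -> I `<=` ideal_add I J.
Proof. by case=> J0 _ _ p Ip; exists p, 0; rewrite addr0. Qed.

Lemma sub_ideal_addr I J : is_ideal I -> J `<=` ideal_add I J.
Proof. by case=> I0 _ _ p Jp; exists 0, p; rewrite add0r. Qed.

Lemma ideal_gen_sub S L : is_ideal L -> S `<=` L -> ideal_gen S `<=` L.
Proof.
case=> L0 LD LM SL p [s [sS ->]]; rewrite big_seq.
by apply: big_ind => // q /sS/SL/LM.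
Qed.

Lemma ideal_add_sub I J L :
  is_ideal L -> I `<=` L -> J `<=` L -> ideal_add I J `<=` L.
Proof. by case=> _ LD _ IL JL p [a [b [/IL La /JL Lb ->]]]; apply: LD. Qed.

End Ideals.

(** With this, a point is shown to be a zero of an ideal by checking the generators only. *)
Lemma vanishing_is_ideal (m : nat) (K : fieldType)
    (iota : {rmorphism rat -> K}) (v : 'I_m -> K) :
  is_ideal [set p : {mpoly rat[m]} | (map_mpoly iota p).@[v] = 0].
Proof.
split=> /= [|p q p0 q0|a p p0]; first by rewrite rmorph0 meval0.
- by rewrite rmorphD mevalD p0 q0 addr0.
- by rewrite rmorphM mevalM p0 mulr0.
Qed.

(** Transfers vanishing at a vertex between the rationals and K. *)
Lemma meval_map_mpoly (m : nat) (R S : comNzRingType) (f : {rmorphism R -> S})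
    (p : {mpoly R[m]}) (v : 'I_m -> R) (w : 'I_m -> S) :
  (forall i, w i = f (v i)) -> (map_mpoly f p).@[w] = f p.@[v].
Proof.
move=> wE; elim/mpolyind: p => [|c n p _ _ IH]; first by rewrite !rmorph0.
rewrite rmorphD /= !mevalD rmorphD IH map_mpolyZ map_mpolyX !mevalZ rmorphM.
congr (_ * _ + _); rewrite !mevalX rmorph_prod.
by apply: eq_bigr => i _; rewrite rmorphXn wE.
Qed.

(** * Ideals containing all x_k^2 - 1 *)

Section Cube.
Variable m : nat.
Implicit Types (s u : {ffun 'I_m -> bool}) (p : {mpoly rat[m]}).

Definition vertex s : 'I_m -> rat := fun i => (-1) ^+ s i.

(** Lagrange interpolation on the cube: the i-th factor is 1 where x_i agrees with the sign s_i and
    0 at the opposite sign. *)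
Definition vertex_ind s : {mpoly rat[m]} :=
  \prod_i ((2^-1)%:MP * (1 + (vertex s i)%:MP * 'X_i)).

Lemma vertex_sqr s i : vertex s i * vertex s i = 1.
Proof. by rewrite -expr2 sqrr_sign. Qed.

(** Expanding the product over i of (1 + x_i)/2 + (1 - x_i)/2 = 1 yields one term per vertex; no
    relation modulo I is involved. *)
Lemma vertex_ind_sum : \sum_s vertex_ind s = 1.
Proof.
pose F i (b : bool) : {mpoly rat[m]} :=
  (2^-1)%:MP * (1 + ((-1) ^+ b)%:MP * 'X_i).
have F1 i : \sum_b F i b = 1.
  rewrite big_bool /F /= expr1 expr0 mpolyCN mpolyC1.
  transitivity ((2^-1 + 2^-1 : rat)%:MP_[m]); first by rewrite mpolyCD; ring.
  by rewrite -mpolyC1; congr mpolyC; field.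
by rewrite -(bigA_distr_bigA F) big1.
Qed.

Lemma meval_vertex_ind s u : (vertex_ind s).@[vertex u] = (s == u)%:R.
Proof.
rewrite rmorph_prod /=; have [->|/eqP su] := eqVneq s u.
  rewrite big1 // => i _; rewrite mevalM mevalD meval1 mevalM !mevalC mevalXU.
  by rewrite vertex_sqr; field.
have [i si] : exists i, s i != u i.
  apply/existsP; rewrite -negb_forall; apply/forallP => e.
  by apply: su; apply/ffunP => i; apply/eqP.
rewrite (bigD1 i) //= mevalM mevalD meval1 mevalM !mevalC mevalXU /vertex.
by case: (s i) (u i) si => [] [] //= _; rewrite ?mulr1 ?mul1r subrr mulr0 mul0r.
Qed.

Lemma vertex_inj s u : vertex s =1 vertex u -> s = u.
Proof. by move=> e; apply/ffunP => i; apply/(@Num.Theory.signr_inj rat)/e. Qed.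

Variable I : set {mpoly rat[m]}.
Hypotheses (idI : is_ideal I) (sqrI : forall i, I ('X_i ^+ 2 - 1)).

(** The polynomials p with this property contain the constants and the variables and are closed
    under sum and product. *)
Lemma mul_vertex_ind p s : I ((p - p.@[vertex s]%:MP) * vertex_ind s).
Proof.
have [I0 ID IM] := idI.
pose Q p := I ((p - p.@[vertex s]%:MP) * vertex_ind s).
have QC c : Q c%:MP by rewrite /Q mevalC subrr mul0r.
have QD q r : Q q -> Q r -> Q (q + r).
  rewrite /Q => Hq Hr; have := ID _ _ Hq Hr.
  by rewrite mevalD mpolyCD; congr I; ring.
(* With values q(s) and r(s): q r - q(s) r(s) = r (q - q(s)) + q(s) (r - r(s)). *)
have QM q r : Q q -> Q r -> Q (q * r).
  rewrite /Q => Hq Hr; have := ID _ _ (IM r _ Hq) (IM q.@[vertex s]%:MP _ Hr).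
  by rewrite mevalM mpolyCM; congr I; ring.
(* For a sign e, (x - e)(1 + e x) = e (x^2 - 1). As [ring] does not know e^2 = 1, the multiple of 1
   - e^2 is split off by hand. *)
have QX i : Q 'X_i.
  rewrite /Q mevalXU /vertex_ind (bigD1 i) //=; set w := \prod_(_ | _) _.
  have := IM ((2^-1 * vertex s i)%:MP * w) _ (sqrI i); congr I.
  rewrite mpolyCM.
  have := congr1 (@mpolyC m rat) (vertex_sqr s i); rewrite mpolyCM mpolyC1.
  set x := 'X_i; set e := (vertex s i)%:MP; set h := mpolyC _ _ => ee.
  transitivity (h * e * w * (x ^+ 2 - 1) + h * w * x * (1 - e * e)).
    by rewrite ee subrr mulr0 addr0.
  by ring.
rewrite -/(Q p); elim/mpolyind: p => [|c n q _ _ Qq].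
  by rewrite -mpolyC0; apply: QC.
apply: QD => //; rewrite -mul_mpolyC; apply: (QM) => //.
rewrite mpolyXE_id; apply: (big_ind Q) => [||i _];
  [by rewrite -mpolyC1|exact: QM|].
by elim: (n i) => [|k IH]; [rewrite expr0 -mpolyC1|rewrite exprS; apply: (QM)].
Qed.

(** Only rational evaluation enters, so one finite set serves every extension K. *)
Definition vertex_zeros : {set {ffun 'I_m -> bool}} :=
  [set s | `[< forall p, I p -> p.@[vertex s] = 0 >]].

Lemma quotient_dim_cube : quotient_dim I #|vertex_zeros|.
Proof.
have [I0 ID IM] := idI.
have IB p s : I p -> I (p.@[vertex s]%:MP * vertex_ind s).
  move=> Ip.
  have := is_idealB idI (IM (vertex_ind s) _ Ip) (mul_vertex_ind p s).
  by congr I; ring.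
(* Some p in I is nonzero at s; modulo I it acts on the indicator as both 0 and the invertible
   scalar p(s). *)
have Inot s : s \notin vertex_zeros -> I (vertex_ind s).
  rewrite inE => /asboolPn/existsNP[p /not_implyP[Ip /eqP nz]].
  have := IM (p.@[vertex s]^-1)%:MP _ (IB p s Ip).
  by rewrite mulrA -mpolyCM mulVf // mpolyC1 mul1r.
exists (fun k => vertex_ind (enum_val k)); split=> [c Ic i|p].
  (* Independence: evaluating the combination at the i-th zero isolates [c i]. *)
  have := enum_valP i; rewrite inE => /asboolP/(_ _ Ic).
  rewrite rmorph_sum (bigD1 i) //= mevalZ meval_vertex_ind eqxx mulr1.
  rewrite big1 ?addr0 // => j ji.
  by rewrite mevalZ meval_vertex_ind (inj_eq enum_val_inj) (negPf ji) mulr0.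
exists (fun k => p.@[vertex (enum_val k)]).
rewrite -(big_enum_val (fun s => p.@[vertex s] *: vertex_ind s)) /=.
(* Spanning: p is multiplied by the sum of all indicators, then replaced by p(s) on each; the terms
   at vertices that are not zeros remain, and they lie in I. *)
have -> : p - \sum_(s in vertex_zeros) p.@[vertex s] *: vertex_ind s =
    \sum_s (p - p.@[vertex s]%:MP) * vertex_ind s
    + \sum_(s | s \notin vertex_zeros) p.@[vertex s]%:MP * vertex_ind s.
  rewrite -{1}[p]mulr1 -vertex_ind_sum mulr_sumr.
  rewrite (bigID (mem vertex_zeros)) /=.
  rewrite [X in _ = X + _](bigID (mem vertex_zeros)) /= addrAC.
  rewrite -sumrB -addrA -big_split /=; congr (_ + _).
    by apply: eq_bigr => s _; rewrite mulrBl mul_mpolyC.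
  by apply: eq_bigr => s _; rewrite mulrBl subrK.
apply: ID; apply: is_ideal_sum => // s.
  by move=> _; apply: mul_vertex_ind.
by move=> sV; apply/IM/Inot.
Qed.

Variables (K : fieldType) (iota : {rmorphism rat -> K}).

Definition vertex_pt s : 'rV[K]_m := \row_i iota (vertex s i).

Lemma vertex_pt_inj : injective vertex_pt.
Proof.
move=> s u /rowP e; apply: vertex_inj => i.
by have := e i; rewrite !mxE => /fmorph_inj.
Qed.

Lemma zero_locus_cube :
  zero_locus iota I =
  [set vertex_pt (enum_val k) | k in [set: 'I_#|vertex_zeros|]].
Proof.
have ev p s : (map_mpoly iota p).@[vertex_pt s 0] = iota p.@[vertex s].
  by apply: meval_map_mpoly => i; rewrite mxE.
apply/seteqP; split=> [v Iv|_ [k _ <-] p Ip]; last first.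
  have := enum_valP k; rewrite inE => /asboolP/(_ _ Ip) p0.
  by rewrite ev p0 rmorph0.
(* Since v_i^2 = 1 in a field, a coordinate other than 1 is -1, which [true] encodes. *)
pose s := [ffun i => v 0 i != 1].
have vE : v = vertex_pt s.
  apply/rowP => i; rewrite mxE /vertex ffunE rmorph_sign.
  have := Iv _ (sqrI i).
  rewrite rmorphB rmorphXn rmorph1 /= map_mpolyX mevalB meval1 rmorphXn.
  rewrite /= mevalXU.
  move/eqP; rewrite subr_eq0 sqrf_eq1.
  by case: eqVneq => [->//|_ /= /eqP->].
have sV : s \in vertex_zeros.
  rewrite inE; apply/asboolP => p Ip; have := Iv p Ip.
  by rewrite vE ev => /eqP; rewrite fmorph_eq0 => /eqP.
by exists (enum_rank_in sV s); rewrite ?enum_rankK_in.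
Qed.

Lemma zero_locus_cube_card : zero_locus iota I #= `I_#|vertex_zeros|.
Proof.
rewrite zero_locus_cube; apply: card_eq_trans (inj_card_eq _) _.
  by move=> k l _ _ /vertex_pt_inj/enum_val_inj.
by rewrite card_eq_sym card_II.
Qed.

End Cube.

Lemma cocycle_sqr (gT : finGroupType) (R : comNzRingType)
    (psi : gT -> gT -> R) :
  cocycle psi -> forall a b, psi a b * psi a b = 1.
Proof. by case=> psi1 _ a b; case: (psi1 a b) => ->; rewrite ?mulrNN mulr1. Qed.

(** * The cocyclic ideal and its zeros *)

Section CocyclicZeros.
Variables (gT : finGroupType) (n : nat) (g : 'I_n -> gT) (idx : gT -> 'I_n).
Hypotheses (gK : cancel g idx) (idxK : cancel idx g).

Let I := cocyclic_ideal g idx.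

Lemma cocyclic_ideal_is_ideal : is_ideal I.
Proof. by do !apply: ideal_add_is_ideal; apply: ideal_gen_is_ideal. Qed.

Lemma norm_gens_sub : norm_gens g idx `<=` I.
Proof.
by move=> p /sub_ideal_gen Ip; do 2!
  [apply: sub_ideal_addl; first exact: ideal_gen_is_ideal].
Qed.

Lemma coc_gens_sub : coc_gens g idx `<=` I.
Proof.
move=> p /sub_ideal_gen Ip; apply: sub_ideal_addl.
  exact: ideal_gen_is_ideal.
by apply: sub_ideal_addr => //; apply: ideal_gen_is_ideal.
Qed.

Lemma row_sum_gens_sub : row_sum_gens g `<=` I.
Proof.
move=> p /sub_ideal_gen Ip; apply: sub_ideal_addr => //.
by apply: ideal_add_is_ideal; apply: ideal_gen_is_ideal.
Qed.

Lemma cocyclic_ideal_sub L : is_ideal L -> norm_gens g idx `<=` L ->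
  coc_gens g idx `<=` L -> row_sum_gens g `<=` L -> I `<=` L.
Proof.
move=> idL NL CL RL.
by do !apply: ideal_add_sub => //; apply: ideal_gen_sub.
Qed.

Variable e : gT.
Hypothesis e1 : e != 1%g.

(** The generators give this directly only for nonidentity i and j; on the first row and column it
    is a multiple of x - 1. The element e supplies the second nonidentity index that [norm_gens]
    asks for. *)
Lemma xvar_sqr_sub i j : I (xvar i j ^+ 2 - 1).
Proof.
have [_ ID IM] := cocyclic_ideal_is_ideal.
have ge : g (idx e) != 1%g by rewrite idxK.
have fromB x : I (x - 1) -> I (x ^+ 2 - 1).
  by move/(IM (x + 1)); congr I; ring.
have id1 k : g k = 1%g -> k = idx 1%g by move=> <-; rewrite gK.
have row1 k : g k != 1%g -> I (xvar (idx 1%g) k - 1).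
  move=> gk; apply: norm_gens_sub.
  by exists (idx e), k; split=> //; constructor 2.
have [/id1->|gi] := eqVneq (g i) 1%g; have [/id1->|gj] := eqVneq (g j) 1%g.
- (* For i = j = 1 the cocycle relation reads x_{1,1} = x_{1,k}^3. *)
  apply: fromB; pose u := xvar (idx 1%g) (idx e).
  have : I (pcoc g idx (idx 1%g) (idx 1%g) (idx e)).
    by apply: coc_gens_sub; exists (idx 1%g), (idx 1%g), (idx e).
  rewrite /pcoc !idxK !mul1g -/u => Ic.
  (* Adding (u^2 + u + 1)(u - 1) = u^3 - 1 to x_{1,1} - u^3 leaves x_{1,1} - 1. *)
  have := ID _ _ Ic (IM (u ^+ 2 + u + 1) _ (row1 _ ge)).
  by congr I; rewrite -/u; ring.
- exact/fromB/row1.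
- by apply/fromB/norm_gens_sub; exists i, (idx e); split=> //; constructor 3.
- by apply: norm_gens_sub; exists i, j; split=> //; constructor 1.
Qed.

Lemma mpolyX_sqr_sub k : I ('X_k ^+ 2 - 1).
Proof. by case/mxvec_indexP: k => i j; apply: xvar_sqr_sub. Qed.

Variables (K : fieldType) (iota : {rmorphism rat -> K}).

Lemma meval_xvar (v : 'rV[K]_(n * n)) i j :
  (map_mpoly iota (xvar i j)).@[v 0] = vec_mx v i j.
Proof. by rewrite map_mpolyX mevalXU mxE. Qed.

Lemma zero_locus_cocyclic (v : 'rV[K]_(n * n)) :
  zero_locus iota I v <->
  [/\ forall i j, vec_mx v i j ^+ 2 = 1,
      forall k, vec_mx v (idx 1%g) k = 1 /\ vec_mx v k (idx 1%g) = 1,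
      forall i j k, vec_mx v i j =
        vec_mx v (idx (g i * g j)%g) k * vec_mx v j k
        * vec_mx v i (idx (g j * g k)%g)
    & forall i, g i != 1%g -> \sum_j vec_mx v i j = 0].
Proof.
have ev2 i j :
    (map_mpoly iota (xvar i j ^+ 2 - 1)).@[v 0] = vec_mx v i j ^+ 2 - 1.
  by rewrite rmorphB rmorphXn rmorph1 /= mevalB meval1 rmorphXn /= meval_xvar.
have ev1 i j : (map_mpoly iota (xvar i j - 1)).@[v 0] = vec_mx v i j - 1.
  by rewrite rmorphB rmorph1 /= mevalB meval1 meval_xvar.
have evc i j k : (map_mpoly iota (pcoc g idx i j k)).@[v 0] =
    vec_mx v i j - vec_mx v (idx (g i * g j)%g) k * vec_mx v j k
        * vec_mx v i (idx (g j * g k)%g).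
  by rewrite rmorphB !rmorphM /= mevalB !mevalM !meval_xvar.
have evr i : (map_mpoly iota (\sum_j xvar i j)).@[v 0] = \sum_j vec_mx v i j.
  rewrite (rmorph_sum (map_mpoly iota)) (rmorph_sum (meval (v 0))).
  by apply: eq_bigr => j _; apply: meval_xvar.
split=> [Iv|[v2 v1 vc vr] p].
  have v2 i j : vec_mx v i j ^+ 2 = 1.
    by apply/subr0_eq; rewrite -ev2; apply/Iv/xvar_sqr_sub.
  have vc i j k : vec_mx v i j = vec_mx v (idx (g i * g j)%g) k * vec_mx v j k
        * vec_mx v i (idx (g j * g k)%g).
    by apply/subr0_eq; rewrite -evc; apply/Iv/coc_gens_sub; exists i, j, k.
  have ge : g (idx e) != 1%g by rewrite idxK.
  have row1 k : g k != 1%g -> vec_mx v (idx 1%g) k = 1.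
    move=> gk; apply/subr0_eq; rewrite -ev1; apply/Iv/norm_gens_sub.
    by exists (idx e), k; split=> //; constructor 2.
  split=> // [k|i gi]; last first.
    by rewrite -evr; apply/Iv/row_sum_gens_sub; exists i.
  have [gk|gk] := eqVneq (g k) 1%g.
    have -> : k = idx 1%g by rewrite -gk gK.
    (* No normalization generator covers x_{1,1}; this instance gives x_{1,1} = x_{1,e}^3 = 1. *)
    have := vc (idx 1%g) (idx 1%g) (idx e).
    by rewrite !idxK !mul1g (row1 _ ge) !mulr1.
  split; first exact: row1.
  apply/subr0_eq; rewrite -ev1; apply/Iv/norm_gens_sub.
  by exists k, (idx e); split=> //; constructor 3.
apply: (cocyclic_ideal_sub (vanishing_is_ideal iota (v 0))) => {}p /=.
- case=> i [j [gi gj [->|->|->]]];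
    by rewrite ?ev2 ?ev1 ?v2 ?(v1 _).1 ?(v1 _).2 subrr.
- by case=> i [j [k ->]]; rewrite evc -vc subrr.
- by case=> i [gi ->]; rewrite evr vr.
Qed.

Lemma card_index : #|gT| = n.
Proof. by rewrite -(card_ord n); apply: bij_eq_card; exists g. Qed.

Lemma sum_index (F : gT -> K) : \sum_(j < n) F (g j) = \sum_b F b.
Proof. by rewrite (reindex g) //; exists idx. Qed.

(* The cocycle relation for (c, b, k) with a = c b turns the inner product of
   rows a and b into psi(c, b) times the sum of row c. *)
Lemma hadamard_cocyclic (psi : gT -> gT -> K) :
  cocycle psi -> normalized psi ->
  (hadamard (cocyclic_mx g psi) <-> forall a, a != 1%g -> \sum_b psi a b = 0).
Proof.
move=> psiC psiN; have [psi1 psic] := psiC.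
have psi2 := cocycle_sqr psiC.
split=> [[_ /matrixP H] a a1|sum0].
  (* Row 1 is constantly 1, so this off-diagonal entry of the Gram matrix is the sum of row a. *)
  have := H (idx a) (idx 1%g).
  rewrite !mxE (inj_eq (can_inj idxK)) (negPf a1) mulr0n => H0.
  rewrite -[RHS]H0 -sum_index; apply: eq_bigr => j _.
  by rewrite !mxE !idxK (psiN _).1 mulr1.
split=> [i j|]; first by rewrite mxE.
apply/matrixP => i j; rewrite !mxE.
have -> : \sum_k cocyclic_mx g psi i k * (cocyclic_mx g psi)^T k j =
    \sum_b psi (g i) b * psi (g j) b.
  by rewrite -sum_index; apply: eq_bigr => k _; rewrite !mxE.
have [->|ij] := eqVneq i j.
  by under eq_bigr do rewrite psi2; rewrite sumr_const card_index.
rewrite mulr0n; set b := g j; pose c := (g i * b^-1)%g.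
have c1 : c != 1%g.
  by rewrite -eq_mulgV1; apply: contra_neq ij => /(can_inj gK).
have -> : g i = (c * b)%g by rewrite mulgKV.
transitivity (psi c b * \sum_k psi c (b * k)%g).
  rewrite mulr_sumr; apply: eq_bigr => k _.
  (* Inserting psi(c, b)^2 = 1 creates the left side of the cocycle relation. *)
  transitivity (psi c b * (psi c b * psi (c * b)%g k) * psi b k).
    by rewrite mulrA psi2 mul1r.
  rewrite psic; transitivity (psi b k * psi b k * (psi c b * psi c (b * k)%g)).
    by ring.
  by rewrite psi2 mul1r.
have -> : \sum_k psi c (b * k)%g = \sum_k psi c k.
  by rewrite [RHS](reindex_inj (mulgI b)).
by rewrite sum0 // mulr0.
Qed.

Lemma zero_locus_cocyclic_hadamard (v : 'rV[K]_(n * n)) :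
  zero_locus iota I v <-> cocyclic_hadamard K g (vec_mx v).
Proof.
split=> [/zero_locus_cocyclic[v2 v1 vc vr]|[H [psi [[p1 pc] pN vE]]]].
  pose psi a b := vec_mx v (idx a) (idx b).
  have psi2 a b : psi a b * psi a b = 1 by rewrite -expr2 v2.
  have vE : vec_mx v = cocyclic_mx g psi.
    by apply/matrixP => i j; rewrite [RHS]mxE /psi !gK.
  have cpsi : cocycle psi.
    split=> [a b|a b c].
      have /eqP := v2 (idx a) (idx b); rewrite sqrf_eq1.
      by case/orP => /eqP; [left|right].
    have := vc (idx a) (idx b) (idx c); rewrite !idxK -!/(psi _ _) => ->.
    transitivity
      (psi (a * b)%g c * psi (a * b)%g c * (psi b c * psi a (b * c)%g)).
      by ring.
    by rewrite psi2 mul1r.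
  have npsi : normalized psi by move=> a; apply: v1.
  split; last by exists psi.
  rewrite vE; apply/hadamard_cocyclic => // a a1.
  rewrite -sum_index -[RHS](vr (idx a)) ?idxK //.
  by apply: eq_bigr => j _; rewrite /psi gK.
have cpsi : cocycle psi by split.
have psi2 := cocycle_sqr cpsi.
apply/zero_locus_cocyclic; rewrite vE; split=> [i j|k|i j k|i gi].
- by rewrite mxE expr2 psi2.
- by rewrite !mxE !idxK; apply: pN.
- rewrite !mxE !idxK.
  have := pc (g i) (g j) (g k).
  move/(congr1 (fun x => x * psi (g i * g j)%g (g k))).
  by rewrite -mulrA psi2 mulr1 => ->; ring.
- move: H; rewrite vE => /(hadamard_cocyclic cpsi pN)/(_ _ gi) sum0.
  by rewrite -[RHS]sum0 -sum_index; apply: eq_bigr => j _; rewrite mxE.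
Qed.

Lemma vec_mx_bij_cocyclic :
  set_bij (zero_locus iota I) (cocyclic_hadamard K g) (fun v => vec_mx v).
Proof.
split=> [v /zero_locus_cocyclic_hadamard //|v w _ _|M HM].
  exact: (can_inj (@vec_mxK _ _ _)).
exists (mxvec M); rewrite ?mxvecK //.
by apply/zero_locus_cocyclic_hadamard; rewrite mxvecK.
Qed.

End CocyclicZeros.

Theorem theorem1 (t : nat) (gT : finGroupType)
    (hG : #|gT| = (4 * t)%N)
    (g : 'I_(4 * t) -> gT) (idx : gT -> 'I_(4 * t))
    (gK : cancel g idx) (idxK : cancel idx g)
    (g1 : val (idx 1%g) = 0%N)
    (K : fieldType) (iota : {rmorphism rat -> K}) :
  [/\ finite_set (zero_locus iota (cocyclic_ideal g idx)),
      set_bij (zero_locus iota (cocyclic_ideal g idx))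
              (cocyclic_hadamard K g)
              (fun v => vec_mx v)
    & exists d : nat,
        cocyclic_hadamard K g #= `I_d /\
        quotient_dim (cocyclic_ideal g idx) d].
Proof.
have [e e1] : exists e : gT, e != 1%g.
  (* The order 4t is positive since the group contains 1, hence t is nonzero and the order is at
     least 4. *)
  have /card_gt1P[x [y [_ _ xy]]] : (1 < #|gT|)%N.
    have : (0 < #|gT|)%N by apply/card_gt0P; exists 1%g.
    by rewrite hG; case: (t) => // k; rewrite mulnS.
  have [x1|] := eqVneq x 1%g; last by exists x.
  by exists y; rewrite -x1 eq_sym.
have idI := cocyclic_ideal_is_ideal g idx.
have sqrI := mpolyX_sqr_sub gK idxK e1.
have bijI := vec_mx_bij_cocyclic gK idxK e1 iota.
have cardI := zero_locus_cube_card sqrI iota.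
split=> //; first by exists #|vertex_zeros (cocyclic_ideal g idx)|.
(* The vertex zeros count both the points of the variety, hence the matrices, and the basis of the
   quotient. *)
exists #|vertex_zeros (cocyclic_ideal g idx)|; split.
  apply: card_eq_trans cardI; rewrite card_eq_sym.
  by have [f _] := Pbij bijI; apply: pcard_eq f.
exact: quotient_dim_cube.
Qed.
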